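(* Let $\pi=\pi_1\cdots\pi_n\in S_n$ and let $1\le i\le n-1$. Then $i$ is a descent of $\pi$ if and only if $\mathrm{bump}_i(\pi)<\mathrm{bump}_{i+1}(\pi)$.
   Context: $S_n$ is the set of permutations $\pi=\pi_1\cdots\pi_n$ (one-line notation) of $\{1,\ldots,n\}$. An index $i\in\{1,\ldots,n-1\}$ is a descent of $\pi$ if $\pi_i>\pi_{i+1}$. Robinson–Schensted (RS) correspondence: tableaux are fillings of Young diagrams with distinct positive integers increasing along rows and down columns. To insert $k$ into a tableau $P$ (written $P\leftarrow k$), start with the top row: (I1) if $k$ is greater than or equal to the rightmost entry of the current row, or the current row is empty, append $k$ at the end of that row and stop; (I2) otherwise let $y$ be the leftmost entry of the current row with $k<y$, replace $y$ by $k$ (this is one bump), set $k:=y$, move down one row and go to (I1). For $\pi\in S_n$, let $P_0$ be the empty tableau and $P_i=P_{i-1}\leftarrow\pi_i$ for $1\le i\le n$. Then $\mathrm{bump}_i(\pi)$ is the number of bumps that occur during the insertion $P_{i-1}\leftarrow\pi_i$. *)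

(* Defs.v *)
(* MathComp world. *)
From mathcomp Require Import all_boot all_fingroup.

Set Implicit Arguments.
Unset Strict Implicit.
Unset Printing Implicit Defensive.

(* 'S_n permutes {0, ..., n-1}; positions and values are both shifted by one,
   so that [one_line pi] is the word pi_1 ... pi_n over {1, ..., n}. *)
Definition one_line n (pi : 'S_n) : seq nat := [seq (pi j).+1 | j <- enum 'I_n].

(* w_i, for 1 <= i <= size w. *)
Definition letter (w : seq nat) (i : nat) : nat := nth 0 w i.-1.

Definition descent n (pi : 'S_n) (i : nat) : bool :=
  (1 <= i <= n - 1) && (letter (one_line pi) i > letter (one_line pi) i.+1).

(* A tableau is the list of its rows, from top to bottom; the rows below the
   last one are empty and are not listed. *)
Definition tableau := seq (seq nat).

(* The tableau P <- k, paired with the number of bumps of this insertion. *)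
Fixpoint insertion (P : tableau) (k : nat) : tableau * nat :=
  match P with
  | [::] => ([:: [:: k]], 0)
  | r :: P' =>
      if nilp r || (last 0 r <= k) then (rcons r k :: P', 0)
      else
        let j := find (fun y => k < y) r in
        let: (Q, b) := insertion P' (nth 0 r j) in
        (set_nth 0 r j k :: Q, b.+1)
  end.

Fixpoint rs_tableau (w : seq nat) (i : nat) : tableau :=
  if i is i'.+1 then (insertion (rs_tableau w i') (letter w i)).1 else [::].

(* Number of bumps in the insertion P_(i-1) <- pi_i, for 1 <= i <= n. *)
Definition bump_count n (pi : 'S_n) (i : nat) : nat :=
  (insertion (rs_tableau (one_line pi) i.-1) (letter (one_line pi) i)).2.

(* Main.v *)
Require Import Defs.
From mathcomp Require Import all_boot all_fingroup.

(** The statement is a form of the row bumping lemma: if [a] and then [b] are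
    inserted into a tableau, the second insertion makes at most as many bumps as
    the first exactly when [a <= b] ([bumps_successive]).  Negated and applied to
    two consecutive letters of the permutation, this is the claim.

    Only one fact about a row matters: in a weakly increasing row, the entry
    bumped by [k] is the least entry exceeding [k] ([insertion_consP]).  Suppose
    that [a] bumps [y] from the first row and that [b] then bumps [z] from the
    row so obtained.
    - If [a <= b], then [z > b >= a], so [z] is an entry of the original row
      exceeding [a], and [y <= z] by minimality of [y].
    - If [b < a], then [a], now in the row, exceeds [b], so [z <= a < y] by
      minimality of [z].
    Hence [y <= z] exactly when [a <= b], and the comparison passes to the next
    row, where [y] and then [z] are inserted.  When one of the insertions stops
    in this row, the bump counts compare directly. *)

(** The new row [r'] after a bump is described only through its entries, not
    their positions: this is all that comparing the letters bumped by two
    successive insertions requires. *)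
Variant insertion_cons_spec (r : seq nat) (P : tableau) (k : nat) :
    tableau * nat -> Prop :=
| InsertionAppend of pairwise leq (rcons r k) & {in r, forall x, x <= k} :
    insertion_cons_spec r P k (rcons r k :: P, 0)
| InsertionBump y r' of pairwise leq r' & k < y
    & y \in r & {in r, forall x, k < x -> y <= x} & k \in r' & {subset r' <= k :: r} :
    insertion_cons_spec r P k
      (r' :: (insertion P y).1, (insertion P y).2.+1).

Lemma pairwise_leq_last (r : seq nat) (x : nat) :
  pairwise leq r -> x \in r -> x <= last 0 r.
Proof.
case/lastP: r => // r m; rewrite last_rcons pairwise_rcons.
by case/andP=> /allP le_m _; rewrite mem_rcons inE => /predU1P[-> | /le_m].
Qed.

Lemma insertion_consP (r : seq nat) (P : tableau) (k : nat) :
  pairwise leq r -> insertion_cons_spec r P k (insertion (r :: P) k).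
Proof.
move=> r_incr /=.
(* On an empty row, the default value 0 of [last] already passes the test. *)
have -> : nilp r || (last 0 r <= k) = (last 0 r <= k) by case: (r).
case: ifPn => [last_le | last_gt].
  have le_k : {in r, forall x, x <= k}.
    by move=> x /(pairwise_leq_last _ _ r_incr)/leq_trans; apply.
  apply: InsertionAppend => //.
  by rewrite pairwise_rcons r_incr andbT; apply/allP.
have r_has : has (fun y => k < y) r.
  apply/hasP; exists (last 0 r); last by rewrite ltnNge.
  by case: (r) last_gt => //= x s _; apply: mem_last.
rewrite set_nthE -has_find r_has [insertion P _]surjective_pairing /=.
move: r_incr; case: (split_find_nth 0 r_has) => y r1 r2 k_lt_y r1_le.
rewrite cat_rcons pairwise_cat /=.
case/and4P=> /allrelP r1_le_r2 r1_incr /allP y_le r2_incr.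
have{} r1_le : {in r1, forall x, x <= k}.
  move=> x x_r1; rewrite leqNgt; apply: contra r1_le => k_lt_x.
  by apply/hasP; exists x.
apply: InsertionBump => //.
- rewrite pairwise_cat /= r1_incr r2_incr !andbT; apply/andP; split.
    apply/allrelP=> u v u_r1; rewrite inE => /predU1P[-> | v_r2].
      exact: r1_le.
    by apply: r1_le_r2 => //; rewrite inE v_r2 orbT.
  by apply/allP=> v /y_le; apply: leq_trans; apply: ltnW.
- by rewrite mem_cat mem_head orbT.
- move=> x; rewrite mem_cat inE => /or3P[/r1_le | /eqP-> // | /y_le //].
  by rewrite leqNgt => /negPf->.
- by rewrite mem_cat mem_head orbT.
- move=> x; rewrite !(mem_cat, inE).
  by case/or3P=> ->; rewrite ?orbT.
Qed.

Lemma insertion_incr (P : tableau) (k : nat) :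
  all (pairwise leq) P -> all (pairwise leq) (insertion P k).1.
Proof.
elim: P k => // r P IHP k /andP[r_incr P_incr].
case: (insertion_consP _ P k r_incr) => [rk_incr _ | y r' r'_incr _ _ _ _ _] /=.
  by rewrite rk_incr.
by rewrite r'_incr IHP.
Qed.

Lemma rs_tableau_incr (w : seq nat) (i : nat) :
  all (pairwise leq) (rs_tableau w i).
Proof. by elim: i => //= i; apply: insertion_incr. Qed.

(** The row bumping lemma, reduced to bump counts.  Stating it as an equality of
    booleans lets one induction handle both orders of [a] and [b], since the
    bumped letters [y] and [z] compare in the same way as [a] and [b]. *)
Lemma bumps_successive (P : tableau) (a b : nat) :
  all (pairwise leq) P ->
  ((insertion (insertion P a).1 b).2 <= (insertion P a).2) = (a <= b).
Proof.
elim: P a b => [|r P IHP] a b; first by rewrite /=; case: leqP.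
case/andP=> r_incr P_incr.
(* Only the pairs are reduced, so that the insertion of [b] stays folded for
   its own case analysis. *)
case: (insertion_consP _ P a r_incr)
    => [ra_incr r_le_a | y r' r'_incr a_lt_y _ y_min a_r' r'_sub];
  rewrite [(_, _).1]/= [(_, _).2]/=.
  case: (insertion_consP _ P b ra_incr)
      => [_ le_b | z s _ b_lt_z z_ra _ _ _] /=.
    by rewrite le_b // mem_rcons mem_head.
  have z_le_a : z <= a.
    by move: z_ra; rewrite mem_rcons => /predU1P[-> | /r_le_a].
  by rewrite ltn0 leqNgt (leq_trans b_lt_z z_le_a).
case: (insertion_consP _ (insertion P y).1 b r'_incr)
    => [_ le_b | z s _ b_lt_z z_r' z_min _ _] /=.
  by rewrite le_b.
rewrite ltnS IHP //; case: (leqP a b) => [a_le_b | b_lt_a].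
  have a_lt_z : a < z by apply: leq_ltn_trans b_lt_z.
  apply: y_min => //.
  by move: (r'_sub z z_r') a_lt_z => /predU1P[-> | //]; rewrite ltnn.
by apply/negbTE; rewrite -ltnNge (leq_ltn_trans (z_min a a_r' b_lt_a)).
Qed.

Theorem proposition12 (n : nat) (pi : 'S_n) (i : nat) (hi : 1 <= i <= n - 1) :
  descent pi i <-> bump_count pi i < bump_count pi i.+1.
Proof.
rewrite /descent hi /=; case: i hi => // i _.
by rewrite [_ < bump_count _ _]ltnNge /bump_count /= bumps_successive
  ?rs_tableau_incr // -ltnNge.
Qed.
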